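(* (i) Every weakly nil clean ring is weakly clean. In particular, every weakly nil clean ring is exchange. (ii) The class of weakly nil clean rings is closed under homomorphic images, direct limits and finite direct products.
   Context: Rings are associative with unity, not necessarily commutative. A ring $R$ is weakly nil clean if for every $a\in R$ there exist an idempotent $e\in R$ and a nilpotent $q\in R$ such that $a-e-q\in eRa$. A ring $R$ is weakly clean (in the sense of Šter) if for every $a\in R$ there exist an idempotent $e\in R$ and a unit $u\in R$ such that $a-e-u\in(1-e)Ra$. A ring $R$ is exchange if for every $a\in R$ there exists an idempotent $e\in Ra$ such that $1-e\in R(1-a)$. *)

(* Defs.v *)
From HB Require Import structures.
From mathcomp Require Import all_boot all_algebra.

Set Implicit Arguments.
Unset Strict Implicit.
Unset Printing Implicit Defensive.

Import GRing.Theory.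
Local Open Scope ring_scope.

(* Rings are [pzRingType]s: associative, unital, not necessarily commutative,
   with the zero ring allowed (it is a homomorphic image of every ring and the
   empty product).  [{rmorphism R -> S}] preserves 1. *)

Definition is_idempotent (R : pzRingType) (e : R) : Prop := e * e = e.

Definition is_nilpotent (R : pzRingType) (q : R) : Prop :=
  exists n : nat, q ^+ n = 0.

(* [GRing.unit] is only available when a decidable set of units is part of the
   structure ([unitRingType]), hence this two-sided definition. *)
Definition is_unit (R : pzRingType) (u : R) : Prop :=
  exists v : R, u * v = 1 /\ v * u = 1.

Definition weakly_nil_clean (R : pzRingType) : Prop :=
  forall a : R, exists e q : R,
    [/\ is_idempotent e, is_nilpotent q &
        exists r : R, a - e - q = e * r * a].

Definition weakly_clean (R : pzRingType) : Prop :=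
  forall a : R, exists e u : R,
    [/\ is_idempotent e, is_unit u &
        exists r : R, a - e - u = (1 - e) * r * a].

Definition exchange (R : pzRingType) : Prop :=
  forall a : R, exists e : R,
    [/\ is_idempotent e,
        exists r : R, e = r * a &
        exists s : R, 1 - e = s * (1 - a)].

Record directed_set (I : Type) (le : I -> I -> Prop) : Prop := DirectedSet {
  directed_inhabited : inhabited I;
  directed_refl : forall i, le i i;
  directed_trans : forall i j k, le i j -> le j k -> le i k;
  directed_ub : forall i j, exists k, le i k /\ le j k }.

(* The laws quantify over all proofs of [le], so a transition map does not
   depend on the proof that indexes it. *)
Record direct_system (I : Type) (le : I -> I -> Prop) := DirectSystem {
  ds_ring : I -> pzRingType;
  ds_map : forall i j, le i j -> {rmorphism ds_ring i -> ds_ring j};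
  ds_map_id : forall i (ii : le i i) x, ds_map ii x = x;
  ds_map_comp : forall i j k (ij : le i j) (jk : le j k) (ik : le i k) x,
    ds_map jk (ds_map ij x) = ds_map ik x }.

Definition is_cocone (I : Type) (le : I -> I -> Prop) (D : direct_system le)
    (S : pzRingType) (psi : forall i, {rmorphism ds_ring D i -> S}) : Prop :=
  forall i j (ij : le i j) x, psi j (ds_map D ij x) = psi i x.

Definition is_direct_limit (I : Type) (le : I -> I -> Prop)
    (D : direct_system le) (L : pzRingType)
    (phi : forall i, {rmorphism ds_ring D i -> L}) : Prop :=
  is_cocone phi /\
  forall (S : pzRingType) (psi : forall i, {rmorphism ds_ring D i -> S}),
    is_cocone psi ->
    exists g : {rmorphism L -> S},
      (forall i x, g (phi i x) = psi i x) /\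
      (forall g' : {rmorphism L -> S},
         (forall i x, g' (phi i x) = psi i x) -> g' =1 g).

(* MathComp only has ring structures on [{ffun I -> R}] with a constant R. *)
Definition direct_product (I : finType) (R : I -> pzRingType) : Type :=
  {dffun forall i : I, R i}.

Section DirectProduct.
Variables (I : finType) (R : I -> pzRingType).
Implicit Types f g h : direct_product R.

HB.instance Definition _ := Choice.on (direct_product R).

Definition dp_zero : direct_product R := [ffun i => 0 : R i].
Definition dp_opp f : direct_product R := [ffun i => - f i : R i].
Definition dp_add f g : direct_product R := [ffun i => f i + g i : R i].
Definition dp_one : direct_product R := [ffun i => 1 : R i].
Definition dp_mul f g : direct_product R := [ffun i => f i * g i : R i].

Fact dp_addA : associative dp_add.
Proof. by move=> f g h; apply/ffunP=> i; rewrite !ffunE addrA. Qed.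
Fact dp_addC : commutative dp_add.
Proof. by move=> f g; apply/ffunP=> i; rewrite !ffunE addrC. Qed.
Fact dp_add0 : left_id dp_zero dp_add.
Proof. by move=> f; apply/ffunP=> i; rewrite !ffunE add0r. Qed.
Fact dp_addN : left_inverse dp_zero dp_opp dp_add.
Proof. by move=> f; apply/ffunP=> i; rewrite !ffunE addNr. Qed.

HB.instance Definition _ := GRing.isZmodule.Build (direct_product R)
  dp_addA dp_addC dp_add0 dp_addN.

Fact dp_mulA : associative dp_mul.
Proof. by move=> f g h; apply/ffunP=> i; rewrite !ffunE mulrA. Qed.
Fact dp_mul1l : left_id dp_one dp_mul.
Proof. by move=> f; apply/ffunP=> i; rewrite !ffunE mul1r. Qed.
Fact dp_mul1r : right_id dp_one dp_mul.
Proof. by move=> f; apply/ffunP=> i; rewrite !ffunE mulr1. Qed.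
Fact dp_mulDl : left_distributive dp_mul dp_add.
Proof. by move=> f g h; apply/ffunP=> i; rewrite !ffunE mulrDl. Qed.
Fact dp_mulDr : right_distributive dp_mul dp_add.
Proof. by move=> f g h; apply/ffunP=> i; rewrite !ffunE mulrDr. Qed.

HB.instance Definition _ := GRing.Zmodule_isPzRing.Build (direct_product R)
  dp_mulA dp_mul1l dp_mul1r dp_mulDl dp_mulDr.

End DirectProduct.

(* Main.v *)
(* If [- a - e - q = e * r * (- a)], then [1 - e] and the unit [- (1 + q)] show that
   [a] is weakly clean.  If [a - e - u = (1 - e) * r * a] with [u] a unit, then
   [e * u = - e * (1 - a)] and [(1 - e) * u] is a left multiple of [a], so the conjugate
   [u^-1 * (1 - e) * u] is the idempotent required by the exchange property.

   The defining equation of a weakly nil clean ring is preserved by ring morphisms and can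
   be solved coordinatewise in a finite product.  The images of the rings of a
   directed system form a subring of the limit, and by the universal property this
   subring is the whole limit. *)
Require Import Defs.
From HB Require Import structures.
From mathcomp Require Import all_boot all_algebra.
From mathcomp Require Import boolp.

Set Implicit Arguments.
Unset Strict Implicit.
Unset Printing Implicit Defensive.

Import GRing.Theory.
Local Open Scope ring_scope.

(** The condition at one element: unlike the condition on the whole ring, it passes along morphisms
    that need not be surjective, such as each [phi i]. *)
Definition weakly_nil_clean_elt (R : pzRingType) (a : R) : Prop :=
  exists e q : R,
    [/\ is_idempotent e, is_nilpotent q & exists r : R, a - e - q = e * r * a].

Lemma is_idempotent_compl (R : pzRingType) (e : R) :
  is_idempotent e -> is_idempotent (1 - e).
Proof.
by move=> ee; rewrite /is_idempotent mulrBr mulr1 mulrBl mul1r ee subrr subr0.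
Qed.

(** The geometric sum gives [q ^+ n - 1 = -1] when multiplied by [q - 1], and it commutes with
    [q - 1], so its opposite is a two-sided inverse. *)
Lemma is_unit_subr_nilpotent (R : pzRingType) (q : R) :
  is_nilpotent q -> is_unit (q - 1).
Proof.
case=> n qn0; exists (- \sum_(i < n) q ^+ i).
have qS : (q - 1) * (\sum_(i < n) q ^+ i) = - 1 by rewrite -subrX1 qn0 sub0r.
have Sq : GRing.comm (q - 1) (\sum_(i < n) q ^+ i).
  apply: commr_sum => i _; apply: commrX; apply: commr_sym.
  by apply: commrB => //; apply: commr1.
by rewrite mulrN mulNr -Sq qS opprK.
Qed.

Lemma is_unit_opp_addr_nilpotent (R : pzRingType) (q : R) :
  is_nilpotent q -> is_unit (- (1 + q)).
Proof.
case=> n qn0; rewrite opprD addrC.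
by apply: is_unit_subr_nilpotent; exists n; rewrite exprNn qn0 mulr0.
Qed.

Lemma weakly_nil_clean_weakly_clean (R : pzRingType) :
  weakly_nil_clean R -> weakly_clean R.
Proof.
move=> wnc a; have [e [q [ee nq [r eqr]]]] := wnc (- a).
exists (1 - e), (- (1 + q)); split.
- exact: is_idempotent_compl.
- exact: is_unit_opp_addr_nilpotent.
(* Both sides equal [a + e + q], the opposite of [- a - e - q]. *)
- exists r; rewrite subKr -[e * r * a]opprK -mulrN -eqr.
  by rewrite !opprB !opprK !addrA subrK addrC [a + e]addrC addrA.
Qed.

Lemma weakly_clean_exchange (R : pzRingType) : weakly_clean R -> exchange R.
Proof.
move=> wc a; have [e [u [ee [v [uv vu]] [r eqr]]]] := wc a.
have eu : e * u = - (e * (1 - a)).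
  (* Left multiplication by [e] kills [(1 - e) * r * a]. *)
  have : e * (a - e - u) = 0.
    by rewrite eqr !mulrA mulrBr mulr1 ee subrr !mul0r.
  rewrite !mulrBr ee mulr1 opprB => /eqP.
  by rewrite subr_eq0 => /eqP.
have fu : (1 - e) * u = (1 - e) * (1 - r) * a.
  rewrite mulrBr mulr1 [RHS]mulrBl -eqr !mulrBl !mul1r eu opprK mulrBr mulr1.
  by rewrite !opprB [RHS]addrC -!addrA addKr.
exists (v * (1 - e) * u); split.
- rewrite /is_idempotent !mulrA -(mulrA (v * (1 - e))) uv mulr1.
  by rewrite -(mulrA v) is_idempotent_compl.
- by exists (v * ((1 - e) * (1 - r))); rewrite -mulrA fu mulrA.
(* Since [v * u = 1], the complementary idempotent is [v * e * u], and [eu] rewrites it. *)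
- exists (- (v * e)); rewrite mulrBr mulr1 mulrBl vu opprB addrC subrK.
  by rewrite -mulrA eu mulrN mulNr mulrA.
Qed.

Lemma weakly_nil_clean_elt_rmorph (R S : pzRingType) (f : {rmorphism R -> S}) (a : R) :
  weakly_nil_clean_elt a -> weakly_nil_clean_elt (f a).
Proof.
move=> [e [q [ee [n qn0] [r eqr]]]]; exists (f e), (f q); split.
- by rewrite /is_idempotent -rmorphM ee.
- by exists n; rewrite -rmorphXn qn0 rmorph0.
- by exists (f r); rewrite -!rmorphB eqr !rmorphM.
Qed.

Lemma weakly_nil_clean_surj (R S : pzRingType) (f : {rmorphism R -> S}) :
  (forall y : S, exists x : R, f x = y) -> weakly_nil_clean R -> weakly_nil_clean S.
Proof.
by move=> fsurj wnc y; have [x <-] := fsurj y; apply: weakly_nil_clean_elt_rmorph.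
Qed.

Section SubringType.
Variables (R : pzRingType) (S : subringClosed R).

(** The universal property quantifies over ring types, so a subring must become a type with its own
    ring structure to serve as a target. *)
Definition subring_type : Type := {x : R | x \in S}.

HB.instance Definition _ := [isSub of subring_type for sval].
HB.instance Definition _ := [Choice of subring_type by <:].
HB.instance Definition _ := 
  GRing.SubChoice_isSubPzRing.Build R _ subring_type (GRing.subringClosedP S).

End SubringType.

Section Corestriction.
Variables (R T : pzRingType) (S : subringClosed R) (f : {rmorphism T -> R}).
Hypothesis fS : forall x, f x \in S.

Definition corestrict (x : T) : subring_type S := Sub (f x) (fS x).

Fact corestrict_is_zmod_morphism : zmod_morphism corestrict.
Proof. by move=> x y; apply: val_inj; rewrite rmorphB !SubK rmorphB. Qed.

Fact corestrict_is_monoid_morphism : monoid_morphism corestrict.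
Proof.
by split=> [|x y]; apply: val_inj; rewrite ?rmorph1 ?rmorphM !SubK ?rmorph1 ?rmorphM.
Qed.

HB.instance Definition _ :=
  GRing.isZmodMorphism.Build T (subring_type S) corestrict corestrict_is_zmod_morphism.
HB.instance Definition _ :=
  GRing.isMonoidMorphism.Build T (subring_type S) corestrict
    corestrict_is_monoid_morphism.

End Corestriction.

Section DirectLimit.
Variables (I : Type) (le : I -> I -> Prop) (D : direct_system le) (L : pzRingType).
Variable phi : forall i : I, {rmorphism ds_ring D i -> L}.
Hypothesis le_dir : directed_set le.

(** Subring structures live on boolean predicates, so the existential is turned into a boolean
    classically. *)
Definition cocone_image : {pred L} := fun x => `[< exists i y, phi i y = x >].

Lemma cocone_imageP (x : L) : reflect (exists i y, phi i y = x) (x \in cocone_image).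
Proof. exact: asboolP. Qed.

Lemma cocone_image_subring : is_cocone phi -> subring_closed cocone_image.
Proof.
move=> coc.
(* By directedness, two images can be lifted to a single ring of the system, where they are
   subtracted or multiplied. *)
have common x y : x \in cocone_image -> y \in cocone_image ->
    exists k x' y', phi k x' = x /\ phi k y' = y.
  move=> /cocone_imageP[i [x' <-]] /cocone_imageP[j [y' <-]].
  have [k [ik jk]] := directed_ub le_dir i j.
  by exists k, (ds_map D ik x'), (ds_map D jk y'); rewrite !coc.
split=> [|x y xP yP|x y xP yP].
- have [i] := directed_inhabited le_dir.
  by apply/cocone_imageP; exists i, 1; rewrite rmorph1.
- have [k [x' [y' [<- <-]]]] := common x y xP yP.
  by apply/cocone_imageP; exists k, (x' - y'); rewrite rmorphB.
- have [k [x' [y' [<- <-]]]] := common x y xP yP.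
  by apply/cocone_imageP; exists k, (x' * y'); rewrite rmorphM.
Qed.

(* The limit maps to the subring of images; composed with the inclusion, this is an
   endomorphism compatible with [phi], hence the identity. *)
Lemma direct_limit_surj : is_direct_limit phi ->
  forall x : L, exists i y, phi i y = x.
Proof.
move=> [coc univ] x; apply/cocone_imageP.
pose Sm := GRing.isSubringClosed.Build L cocone_image (cocone_image_subring coc).
pose S : subringClosed L := HB.pack cocone_image Sm.
have phiS i y : phi i y \in S by apply/cocone_imageP; exists i, y.
pose psi i : {rmorphism ds_ring D i -> subring_type S} := corestrict (phiS i).
have psi_coc : is_cocone psi.
  by move=> i j ij y; apply: val_inj; rewrite !SubK coc.
have [g [g_psi _]] := univ _ psi psi_coc.
have [h [_ h_uniq]] := univ L phi coc.
pose k : {rmorphism L -> L} := (val : subring_type S -> L) \o g.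
have -> : x = k x.
  rewrite (h_uniq k) => [|i y]; last by rewrite /= g_psi SubK.
  by rewrite -(h_uniq idfun).
exact: (valP (g x)).
Qed.

Lemma weakly_nil_clean_direct_limit : is_direct_limit phi ->
  (forall i : I, weakly_nil_clean (ds_ring D i)) -> weakly_nil_clean L.
Proof.
move=> lim wnc x; have [i [y <-]] := direct_limit_surj lim x.
exact/weakly_nil_clean_elt_rmorph/wnc.
Qed.

End DirectLimit.

Lemma direct_product_exprE (I : finType) (R : I -> pzRingType)
  (f : direct_product R) (n : nat) (i : I) : (f ^+ n) i = f i ^+ n.
Proof. by elim: n => [|n IHn]; rewrite ?expr0 ?exprS !ffunE // IHn. Qed.

Lemma weakly_nil_clean_direct_product (I : finType) (R : I -> pzRingType) :
  (forall i : I, weakly_nil_clean (R i)) -> weakly_nil_clean (direct_product R).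
Proof.
move=> wnc a.
(* The exponent is bundled with the ring elements, so that one use of choice selects all the data in
   each coordinate. *)
have /(_ _)/cid sol i : exists t : R i * R i * R i * nat,
    let: (e, q, r, n) := t in
    [/\ is_idempotent e, q ^+ n = 0 & a i - e - q = e * r * a i].
  by have [e [q [ee [n qn0] [r eqr]]]] := wnc i (a i); exists (e, q, r, n).
pose n i := (sval (sol i)).2.
exists [ffun i => (sval (sol i)).1.1.1], [ffun i => (sval (sol i)).1.1.2]; split.
- apply/ffunP=> i; rewrite !ffunE.
  by case: (sol i) => [[[[e q] r] m] []].
(* The sum is finite and at least each [n i], so it is a nilpotency exponent in every coordinate at
   once. *)
- exists (\sum_i n i)%N; apply/ffunP=> i.
  rewrite direct_product_exprE !ffunE (bigD1 i) //= exprD /n.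
  by case: (sol i) => [[[[e q] r] m] [/= _ -> _]]; rewrite mul0r.
- exists [ffun i => (sval (sol i)).1.2]; apply/ffunP=> i; rewrite !ffunE.
  by case: (sol i) => [[[[e q] r] m] []].
Qed.

Theorem proposition2p4 :
  ((forall R : pzRingType, weakly_nil_clean R -> weakly_clean R) /\
   (forall R : pzRingType, weakly_nil_clean R -> exchange R)) /\
  ((forall (R S : pzRingType) (f : {rmorphism R -> S}),
      (forall y : S, exists x : R, f x = y) ->
      weakly_nil_clean R -> weakly_nil_clean S) /\
   (forall (I : Type) (le : I -> I -> Prop) (D : direct_system le)
           (L : pzRingType) (phi : forall i : I, {rmorphism ds_ring D i -> L}),
      directed_set le ->
      is_direct_limit phi ->
      (forall i : I, weakly_nil_clean (ds_ring D i)) ->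
      weakly_nil_clean L) /\
   (forall (I : finType) (R : I -> pzRingType),
      (forall i : I, weakly_nil_clean (R i)) ->
      weakly_nil_clean (direct_product R))).
Proof.
split; first split.
- exact: weakly_nil_clean_weakly_clean.
- by move=> R /weakly_nil_clean_weakly_clean; apply: weakly_clean_exchange.
split; first exact: weakly_nil_clean_surj.
split; first exact: weakly_nil_clean_direct_limit.
exact: weakly_nil_clean_direct_product.
Qed.
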